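(* Let $\phi,A_1,A_2,A_3\in B$ (the Moyal--Weyl algebra), $\mathbf A=(A_1,A_2,A_3)$, and let $A^\omega(\vartheta)=\phi\,dx^0-A_1\,dx^1-A_2\,dx^2-A_3\,dx^3\in\Omega^1(B)$ be the corresponding non-commutative gauge potential, with field strength $F^\omega(\vartheta)=dA^\omega(\vartheta)-i\,A^\omega(\vartheta)\wedge A^\omega(\vartheta)$, and let $\mathbf D,\mathbf H$ be the fields defined in the context. Then the non-commutative Yang--Mills equation (dynamical equation) $$(d^\star-d^{S^\omega\star})F^\omega(\vartheta)=0$$ is given in coordinates by the non-commutative Gauss law and the non-commutative Ampere equation $$\nabla\cdot\mathbf D=\rho^e,\qquad\nabla\times\mathbf H-\frac{\partial\mathbf D}{\partial x^0}=\mathbf j^e,$$ where $$\rho^e=i[\mathbf D,\mathbf A^*],\qquad\mathbf j^e=i[\mathbf D,\phi^*]-i(\mathbf H\times\mathbf A^*+\mathbf A^*\times\mathbf H).$$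
   Context: Fix an antisymmetric $4\times4$ matrix $(\theta^{\mu\nu})$; its entries are treated as formal central parameters fixed by complex conjugation. $B=C^\infty_{\mathbb C}(\mathbb R^4)[[\theta^{\mu\nu}]]$ is the space of formal power series in $\theta^{\mu\nu}$ with coefficients in complex-valued smooth functions of $(x^0,x^1,x^2,x^3)$, with the Moyal product $f\cdot h=m\circ\exp\left(\frac{i\theta^{\mu\nu}}{2}\frac{\partial}{\partial x^\mu}\otimes\frac{\partial}{\partial x^\nu}\right)(f\otimes h)$ ($m$ the pointwise product, $i=\sqrt{-1}$) and $*$ = complex conjugation. $\Omega^\bullet(B)=\Omega^\bullet_{\mathbb C}(\mathbb R^4)[[\theta^{\mu\nu}]]$ with the usual differential $d$ and product $(f\,dx^I)\wedge(h\,dx^J)=(f\cdot h)\,dx^I\wedge dx^J$. Hodge operator. $\star:\Omega^k(B)\to\Omega^{4-k}(B)$ is antilinear, $\star(f\,dx^I)=f^*\cdot\star dx^I$, with (writing $dx^{\mu\nu\cdots}=dx^\mu\wedge dx^\nu\wedge\cdots$) $\star\mathbf 1=dx^{0123}$, $\star dx^{0123}=-\mathbf 1$; $\star dx^0=dx^{123}$, $\star dx^1=dx^{023}$, $\star dx^2=-dx^{013}$, $\star dx^3=dx^{012}$; $\star dx^{01}=-dx^{23}$, $\star dx^{02}=dx^{13}$, $\star dx^{03}=-dx^{12}$, $\star dx^{12}=dx^{03}$, $\star dx^{13}=-dx^{02}$, $\star dx^{23}=dx^{01}$; $\star dx^{123}=dx^0$, $\star dx^{023}=dx^1$, $\star dx^{013}=-dx^2$,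 $\star dx^{012}=dx^3$. (It is the Hodge operator of the Minkowski metric $\mathrm{diag}(1,-1,-1,-1)$ made antilinear.) The codifferential is $d^\star:=(-1)^{k+1}\star^{-1}\circ d\circ\star:\Omega^{k+1}(B)\to\Omega^k(B)$. Here $\vartheta$ is a basis vector of the one-dimensional quantum dual Lie algebra ${}_{\mathrm{inv}}\Gamma$ of $U(1)$; a non-commutative gauge potential is a linear map $A^\omega:{}_{\mathrm{inv}}\Gamma\to\Omega^1(B)$, determined by $A^\omega(\vartheta)$. For a linear map $T:{}_{\mathrm{inv}}\Gamma\to\Omega^{k+1}(B)$, $d^{S^\omega\star}T(\vartheta):=(-1)^k\,i\,\star^{-1}\left([A^\omega(\vartheta),\star T(\vartheta)]^\partial\right)$, where $[\alpha,\beta]^\partial:=\alpha\wedge\beta-(-1)^l\beta\wedge\alpha$ for $\alpha\in\Omega^1(B)$, $\beta\in\Omega^l(B)$. (It is the formal adjoint of $T\mapsto d^{S^\omega}T$, $d^{S^\omega}T(\vartheta)=i[A^\omega(\vartheta),T(\vartheta)]^\partial$.) Writing $F^\omega(\vartheta)=\sum_{0\le\mu<\nu\le3}F_{\mu\nu}\,dx^\mu\wedge dx^\nu$, one has $F_{0j}=D_j$ for $j=1,2,3$, $F_{12}=-H_3$, $F_{13}=H_2$, $F_{23}=-H_1$, where $$\mathbf D:=\mathbf E+i[\phi,\mathbf A],\quad\mathbf E:=-\frac{\partial\mathbf A}{\partial x^0}-\nabla\phi,\qquad\mathbf H:=\mathbf B+i\,\mathbf A\times\mathbf A,\quad\mathbf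 B:=\nabla\times\mathbf A.$$ $\mathbf A^*=(A_1^*,A_2^*,A_3^* )$. All products are Moyal products; $\nabla$ is the gradient in $x^1,x^2,x^3$. For $f\in B$ and $\mathbf U,\mathbf V\in B^3$: $[f,\mathbf V]=([f,V_j])_j$ and $[\mathbf V,f]=([V_j,f])_j$ with $[f,h]=f\cdot h-h\cdot f$; $[\mathbf U,\mathbf V]=\sum_{j=1}^3[U_j,V_j]$; $(\mathbf U\times\mathbf V)_1=U_2\cdot V_3-U_3\cdot V_2$ and cyclically (entry of $\mathbf U$ first). *)

(* Defs.v *)
From HB Require Import structures.
From mathcomp Require Import all_boot all_order all_algebra.
From mathcomp Require Import complex.
From mathcomp Require Import boolp classical_sets functions reals topology.
From mathcomp Require Import normedtype derive.
Set Implicit Arguments.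
Unset Strict Implicit.
Unset Printing Implicit Defensive.
Import Order.TTheory GRing.Theory Num.Theory.
Import numFieldNormedType.Exports.
Local Open Scope ring_scope.

Section Smooth.
Variable R : realType.
Local Notation X := 'rV[R]_4.
Local Notation C := R[i].

(* The coordinates x^0, ..., x^3 of x : X are the entries x 0 mu. *)
Definition base (mu : 'I_4) : X := delta_mx 0 mu.

Fixpoint Ck (n : nat) (u : X -> R) : Prop :=
  continuous u /\
  if n is m.+1 then
    forall mu, (forall x, derivable u x (base mu)) /\ Ck m ('D_(base mu) u)
  else True.

Definition smooth (f : X -> C) : Prop :=
  forall n,
    Ck n (fun x => complex.Re (f x)) /\ Ck n (fun x => complex.Im (f x)).

Definition partial (mu : 'I_4) (f : X -> C) : X -> C := fun x =>
  Complex ('D_(base mu) (fun y => complex.Re (f y)) x)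
          ('D_(base mu) (fun y => complex.Im (f y)) x).

Lemma Ck_continuous n u : Ck n u -> continuous u.
Proof. by case: n => [|n] []. Qed.

Lemma CkS n u : Ck n.+1 u -> Ck n u.
Proof.
elim: n u => [|n IH] u [cu du]; split=> // mu.
by have [d1 d2] := du mu; split=> //; apply: IH.
Qed.

Lemma Ck_cst n (c : R) : Ck n (fun=> c).
Proof.
elim: n c => [|n IH] c; split=> //; try exact: cst_continuous.
move=> mu; split=> [x|]; first exact: derivable_cst.
have -> : 'D_(base mu) (fun=> c) = (fun=> 0) :> (X -> R).
  by apply/funext => x; exact: derive_cst.
exact: IH.
Qed.

Lemma CkD n (u v : X -> R) : Ck n u -> Ck n v -> Ck n (u + v).
Proof.
elim: n u v => [|n IH] u v [cu du] [cv dv]; split=> //.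
- by move=> x; exact: (cvgD (cu x) (cv x)).
- by move=> x; exact: (cvgD (cu x) (cv x)).
move=> mu; have [du1 du2] := du mu; have [dv1 dv2] := dv mu.
split=> [x|]; first exact: derivableD.
have -> : 'D_(base mu) (u + v) = 'D_(base mu) u + 'D_(base mu) v.
  by apply/funext => x; exact: deriveD.
exact: IH.
Qed.

Lemma CkN n (u : X -> R) : Ck n u -> Ck n (- u).
Proof.
elim: n u => [|n IH] u [cu du]; split=> //.
- by move=> x; exact: (cvgN (cu x)).
- by move=> x; exact: (cvgN (cu x)).
move=> mu; have [du1 du2] := du mu.
split=> [x|]; first exact: derivableN.
have -> : 'D_(base mu) (- u) = - 'D_(base mu) u.
  by apply/funext => x; exact: deriveN.
exact: IH.
Qed.

Lemma Ck_contM (u v : X -> R) (x : X) :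
  continuous u -> continuous v -> continuous_at x (u * v).
Proof.
move=> hu hv; have H := @continuousM R X u v x (hu x) (hv x).
by refine H.
Qed.

Lemma CkM n (u v : X -> R) : Ck n u -> Ck n v -> Ck n (u * v).
Proof.
elim: n u v => [|n IH] u v hu hv.
  by split=> // x; apply: Ck_contM; apply: Ck_continuous; eassumption.
split=> [x|mu].
  by apply: Ck_contM; apply: Ck_continuous; eassumption.
have [du1 du2] := hu.2 mu; have [dv1 dv2] := hv.2 mu.
split=> [x|]; first exact: derivableM.
have -> : 'D_(base mu) (u * v) = u * 'D_(base mu) v + v * 'D_(base mu) u.
  by apply/funext => x; exact: deriveM.
by apply: CkD; apply: IH => //; apply: CkS.
Qed.

Definition smooth_pred : {pred X -> C} := fun f => `[< smooth f >].

Fact smooth_subring : subring_closed smooth_pred.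
Proof.
split=> [|f h|f h].
- by apply/asboolP => n; split; exact: Ck_cst.
- move=> /asboolP sf /asboolP sh; apply/asboolP => n.
  have [rf jf] := sf n; have [rh jh] := sh n; split.
  + have -> : (fun x => complex.Re ((f - h) x)) =
      (fun x => complex.Re (f x)) - (fun x => complex.Re (h x)).
      by apply/funext => x; rewrite /= !fctE; case: (f x) (h x) => ? ? [? ?].
    by apply: CkD => //; apply: CkN.
  + have -> : (fun x => complex.Im ((f - h) x)) =
      (fun x => complex.Im (f x)) - (fun x => complex.Im (h x)).
      by apply/funext => x; rewrite /= !fctE; case: (f x) (h x) => ? ? [? ?].
    by apply: CkD => //; apply: CkN.
- move=> /asboolP sf /asboolP sh; apply/asboolP => n.
  have [rf jf] := sf n; have [rh jh] := sh n; split.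
  + have -> : (fun x => complex.Re ((f * h) x)) =
      (fun x => complex.Re (f x)) * (fun x => complex.Re (h x)) -
      (fun x => complex.Im (f x)) * (fun x => complex.Im (h x)).
      by apply/funext => x; rewrite /= !fctE; case: (f x) (h x) => ? ? [? ?].
    by apply: CkD; [apply: CkM|apply: CkN; apply: CkM].
  + have -> : (fun x => complex.Im ((f * h) x)) =
      (fun x => complex.Re (f x)) * (fun x => complex.Im (h x)) +
      (fun x => complex.Im (f x)) * (fun x => complex.Re (h x)).
      by apply/funext => x; rewrite /= !fctE; case: (f x) (h x) => ? ? [? ?].
    by apply: CkD; apply: CkM.
Qed.

HB.instance Definition _ :=
  GRing.isSubringClosed.Build (X -> C) smooth_pred smooth_subring.

Fact smooth_scale : scaler_closed smooth_pred.
Proof.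
move=> c f sf; have -> : c *: f = (fun=> c) * f by [].
apply: rpredM => //; apply/asboolP => n; split; exact: Ck_cst.
Qed.

HB.instance Definition _ :=
  GRing.isScaleClosed.Build C (X -> C) smooth_pred smooth_scale.

Record Cinf := MkCinf { Cinf_fun :> X -> C; _ : Cinf_fun \in smooth_pred }.

HB.instance Definition _ := [isSub for Cinf_fun].
HB.instance Definition _ := [Choice of Cinf by <:].
HB.instance Definition _ :=
  GRing.SubChoice_isSubComPzRing.Build _ _ Cinf (subringClosedP _).
HB.instance Definition _ := [SubZmodule_isSubLmodule of Cinf by <:].

Lemma Cinf_smooth (f : Cinf) : smooth f.
Proof. by apply/asboolP; case: f. Qed.

Fact partial_smooth mu (f : Cinf) : partial mu f \in smooth_pred.
Proof.
apply/asboolP => n.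
by have [[_ /(_ mu)[_ ?]] [_ /(_ mu)[_ ?]]] := Cinf_smooth f n.+1.
Qed.

Definition Cinf_partial mu (f : Cinf) : Cinf := MkCinf (partial_smooth mu f).

Fact conj_smooth (f : Cinf) : (fun x => conjc (f x)) \in smooth_pred.
Proof.
apply/asboolP => n; have [rf jf] := Cinf_smooth f n; split.
  have -> // : (fun x => complex.Re (conjc (f x))) = (fun x => complex.Re (f x)).
  by apply/funext => x; case: (f x).
have -> : (fun x => complex.Im (conjc (f x))) = - (fun x => complex.Im (f x)).
  by apply/funext => x; rewrite !fctE; case: (f x).
exact: CkN.
Qed.

Definition Cinf_conj (f : Cinf) : Cinf := MkCinf (conj_smooth f).

End Smooth.

Arguments Cinf_partial {R} mu f.
Arguments Cinf_conj {R} f.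

(* An antisymmetric 4 x 4 matrix has six independent entries theta^{mu nu},
   mu < nu: these are the formal parameters, and a monomial in them is given by
   its exponents. *)
Notation param := {p : 'I_4 * 'I_4 | (p.1 < p.2)%N}.
Notation multi := {ffun param -> nat}.

Section Moyal.
Variable R : realType.
Local Notation C := R[i].

(* f g is the coefficient of theta^g. The product of the algebra is [moyal]. *)
Definition MoyalWeyl : Type := multi -> Cinf R.
HB.instance Definition _ := GRing.Lmodule.copy MoyalWeyl (multi -> Cinf R).

Implicit Types f h : MoyalWeyl.

Definition pd (mu : 'I_4) f : MoyalWeyl := fun g => Cinf_partial mu (f g).
Definition mwconj f : MoyalWeyl := fun g => Cinf_conj (f g).

Definition theta (mu nu : 'I_4) : MoyalWeyl := fun g =>
  if insub (mu, nu) is Some p then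
    ((g == [ffun q : param => nat_of_bool (q == p)])%:R : Cinf R)
  else if insub (nu, mu) is Some p then
    - ((g == [ffun q : param => nat_of_bool (q == p)])%:R : Cinf R)
  else 0.

(* The commutative product of formal power series. *)
Definition mulps f h : MoyalWeyl := fun g : multi =>
  \sum_(a : {dffun forall p : param, 'I_(g p).+1})
    f [ffun p => nat_of_ord (a p)] * h [ffun p => (g p - a p)%N].

(* m o (theta^{mu nu} d_mu (x) d_nu)^n applied to f (x) h. *)
Fixpoint bidiff (n : nat) f h : MoyalWeyl :=
  if n is m.+1 then
    \sum_(mu < 4) \sum_(nu < 4)
      mulps (theta mu nu) (bidiff m (pd mu f) (pd nu h))
  else mulps f h.

(* The coefficients of the exponential series; by [bidiff_small] below only the
   terms with n at most the total degree of g contribute to that of theta^g. *)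
Definition moyal f h : MoyalWeyl := fun g : multi =>
  \sum_(n < (\sum_p g p).+1) (n`!%:R^-1 * ('i%C / 2) ^+ n) *: bidiff n f h g.

Lemma mw_sumE (I : Type) (r : seq I) (P : pred I) (F : I -> MoyalWeyl) g :
  (\sum_(i <- r | P i) F i) g = \sum_(i <- r | P i) F i g.
Proof. by elim/big_rec2: _ => // i x y _ <-. Qed.

Lemma bidiff_small n f h (g : multi) : (\sum_p g p < n)%N -> bidiff n f h g = 0.
Proof.
elim: n f h g => [//|n IH] f h g gn /=.
rewrite mw_sumE big1 // => mu _; rewrite mw_sumE big1 // => nu _.
rewrite /mulps big1 // => a _.
pose b : multi := [ffun p => nat_of_ord (a p)].
have [b0|b0] := eqVneq (\sum_p b p)%N 0%N; last first.
  rewrite IH ?mulr0 //.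
  have: (\sum_p g p = \sum_p b p + \sum_p [ffun p => (g p - a p)%N] p)%N.
    rewrite -big_split; apply: eq_bigr => p _ /=; rewrite !ffunE subnKC //.
    by rewrite -ltnS.
  move=> E; rewrite -ltnS; apply: leq_trans gn.
  by rewrite E ltnS -[X in (X < _)%N]add0n ltn_add2r lt0n.
have bn p : (b == [ffun q : param => nat_of_bool (q == p)]) = false.
  apply/eqP => eb; move: b0; rewrite (bigD1 p) //= eb ffunE eqxx.
  by rewrite add1n.
rewrite /theta -/b; case: insubP => [p _ _|_]; first by rewrite bn mul0r.
by case: insubP => [p _ _|_]; rewrite ?bn ?oppr0 mul0r.
Qed.

Lemma partial0 mu : pd mu 0 = 0.
Proof.
apply/funext => g; apply/val_inj/funext => x /=; rewrite /partial /=.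
have E : 'D_(base R mu) (fun _ => 0 : R) x = 0 by exact: derive_cst.
by rewrite [X in Complex X _]E [X in Complex _ X]E.
Qed.

Lemma mwconj0 : mwconj 0 = 0.
Proof.
apply/funext => g; apply/val_inj/funext => x /=.
by rewrite oppr0.
Qed.

Lemma mulpsr0 f : mulps f 0 = 0.
Proof. by apply/funext => g; rewrite /mulps big1 // => a _; rewrite mulr0. Qed.

Lemma mulps0r f : mulps 0 f = 0.
Proof. by apply/funext => g; rewrite /mulps big1 // => a _; rewrite mul0r. Qed.

Lemma bidiffr0 n f : bidiff n f 0 = 0.
Proof.
elim: n f => [|n IH] f /=; first exact: mulpsr0.
by rewrite big1 // => mu _; rewrite big1 // => nu _; rewrite partial0 IH mulpsr0.
Qed.

Lemma bidiff0r n f : bidiff n 0 f = 0.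
Proof.
elim: n f => [|n IH] f /=; first exact: mulps0r.
by rewrite big1 // => mu _; rewrite big1 // => nu _; rewrite partial0 IH mulpsr0.
Qed.

Lemma moyalr0 f : moyal f 0 = 0.
Proof.
by apply/funext => g; rewrite /moyal big1 // => n _; rewrite bidiffr0 scaler0.
Qed.

Lemma moyal0r f : moyal 0 f = 0.
Proof.
by apply/funext => g; rewrite /moyal big1 // => n _; rewrite bidiff0r scaler0.
Qed.

End Moyal.

Section Forms.
Variable R : realType.
Local Notation C := R[i].
Local Notation B := (MoyalWeyl R).

(* The form with components (w_I) is the sum of the w_I dx^I, where dx^I is the
   wedge product of the dx^mu, mu in I, in increasing order. *)
Definition forms : Type := {ffun {set 'I_4} -> B}.
HB.instance Definition _ := GRing.Lmodule.copy forms {ffun {set 'I_4} -> B}.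

Implicit Types w : forms.

(* dx^I /\ dx^J = wedge_sign I J dx^(I :|: J) for disjoint I and J. *)
Definition wedge_sign (I J : {set 'I_4}) : C :=
  (-1) ^+ #|[set p : 'I_4 * 'I_4 | [&& p.1 \in I, p.2 \in J & (p.2 < p.1)%N]]|.

Definition dform w : forms :=
  [ffun K : {set 'I_4} => \sum_(mu in K)
     wedge_sign [set mu] (K :\ mu) *: pd mu (w (K :\ mu))].

Definition wedgeform (v w : forms) : forms :=
  [ffun K : {set 'I_4} => \sum_(I : {set 'I_4} | I \subset K)
     wedge_sign I (K :\: I) *: moyal (v I) (w (K :\: I))].

Definition mset (s : seq nat) : {set 'I_4} := [set mu : 'I_4 | val mu \in s].

(* star dx^I = hodge_sign I dx^(~: I); the sets listed are those whose image
   carries a minus sign. *)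
Definition hodge_sign (I : {set 'I_4}) : C :=
  if I \in [:: mset [:: 0; 1; 2; 3]; mset [:: 2]; mset [:: 0; 1];
               mset [:: 0; 3]; mset [:: 1; 3]; mset [:: 0; 1; 3]]%N
  then -1 else 1.

Definition hodgeform w : forms :=
  [ffun J : {set 'I_4} => hodge_sign (~: J) *: mwconj (w (~: J))].

Definition hodgeinv w : forms :=
  [ffun I : {set 'I_4} => hodge_sign I *: mwconj (w (~: I))].

Lemma hodge_signK I (f : B) :
  hodge_sign I *: mwconj (hodge_sign I *: mwconj f) = f.
Proof.
rewrite /hodge_sign; case: ifP => _; apply/funext => g; apply/val_inj/funext => x.
  rewrite /= !fctE /=; case: (f g x) => a b; apply/eqP; rewrite eq_complex /=.
  by rewrite !oppr0 !(mul0r, mulN1r, subr0, addr0, opprK) !eqxx.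
rewrite /= !fctE /=; case: (f g x) => a b; apply/eqP; rewrite eq_complex /=.
by rewrite !(mul0r, mul1r, subr0, addr0, opprK) !eqxx.
Qed.

Lemma hodgeformK : cancel hodgeform hodgeinv.
Proof.
by move=> w; apply/ffunP => I; rewrite !ffunE finset.setCK hodge_signK.
Qed.

Lemma hodgeinvK : cancel hodgeinv hodgeform.
Proof.
by move=> w; apply/ffunP => I; rewrite !ffunE finset.setCK hodge_signK.
Qed.

Definition homog (k : nat) : {pred forms} :=
  fun w => [forall I : {set 'I_4}, (#|I| != k) ==> (w I == 0)].

Lemma homogP k w : reflect (forall I : {set 'I_4}, #|I| != k -> w I = 0) (w \in homog k).
Proof.
apply: (iffP forallP) => H I; first by move=> Ik; apply/eqP/(implyP (H I)).
by apply/implyP => Ik; rewrite H.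
Qed.

Fact homog_submod k : submod_closed (homog k).
Proof.
split; first by apply/homogP => I _; rewrite ffunE.
move=> c v w /homogP hv /homogP hw; apply/homogP => I Ik.
by rewrite !ffunE hv // hw // scaler0 addr0.
Qed.

HB.instance Definition _ k :=
  GRing.isSubmodClosed.Build C forms (homog k) (homog_submod k).

Record Omega (k : nat) :=
  MkOmega { Omega_form :> forms; _ : Omega_form \in homog k }.

HB.instance Definition _ k := [isSub for @Omega_form k].
HB.instance Definition _ k := [Choice of Omega k by <:].
HB.instance Definition _ k := [SubChoice_isSubZmodule of Omega k by <:].
HB.instance Definition _ k := [SubZmodule_isSubLmodule of Omega k by <:].

Lemma Omega_homog k (w : Omega k) : (w : forms) \in homog k.
Proof. by case: w. Qed.

Lemma card_setC4 (I : {set 'I_4}) : #|~: I| = (4 - #|I|)%N.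
Proof. by have := cardsC I; rewrite card_ord => /(canRL (addKn _)). Qed.

Lemma leq_card4 (I : {set 'I_4}) : (#|I| <= 4)%N.
Proof. by have := max_card I; rewrite card_ord. Qed.

Lemma homog_gt4 k w : (4 < k)%N -> w \in homog k -> w = 0.
Proof.
move=> k4 /homogP hw; apply/ffunP => I; rewrite hw ?ffunE //.
by rewrite neq_ltn (leq_ltn_trans (leq_card4 I) k4).
Qed.

Lemma dform0 : dform 0 = 0.
Proof.
apply/ffunP => K; rewrite !ffunE big1 // => mu _.
by rewrite ffunE partial0 scaler0.
Qed.

Lemma hodgeinv0 : hodgeinv 0 = 0.
Proof. by apply/ffunP => I; rewrite !ffunE mwconj0 scaler0. Qed.

Lemma hodgeform0 : hodgeform 0 = 0.
Proof. by apply/ffunP => I; rewrite !ffunE mwconj0 scaler0. Qed.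

Lemma wedgeform0r w : wedgeform 0 w = 0.
Proof.
apply/ffunP => K; rewrite !ffunE big1 // => I _.
by rewrite ffunE moyal0r scaler0.
Qed.

Lemma wedgeformr0 w : wedgeform w 0 = 0.
Proof.
apply/ffunP => K; rewrite !ffunE big1 // => I _.
by rewrite ffunE moyalr0 scaler0.
Qed.

Lemma dform_homog k w : w \in homog k -> dform w \in homog k.+1.
Proof.
move=> /homogP hw; apply/homogP => K Kk; rewrite ffunE big1 // => mu muK.
by rewrite hw ?partial0 ?scaler0 //; move: Kk; rewrite (cardsD1 mu K) muK.
Qed.

Lemma wedgeform_homog k l v w :
  v \in homog k -> w \in homog l -> wedgeform v w \in homog (k + l).
Proof.
move=> /homogP hv /homogP hw; apply/homogP => K Kk; rewrite ffunE big1 // => I IK.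
have [Ik|Ik] := eqVneq #|I| k; last by rewrite hv // moyal0r scaler0.
rewrite hw ?moyalr0 ?scaler0 //; apply: contra Kk => /eqP <-.
by rewrite -Ik -(cardsID I K) (finset.setIidPr IK).
Qed.

Lemma hodgeform_homog k w : w \in homog k -> hodgeform w \in homog (4 - k).
Proof.
move=> /homogP hw; apply/homogP => J Jk; rewrite ffunE.
rewrite hw ?mwconj0 ?scaler0 //; apply: contra Jk => /eqP <-.
by rewrite card_setC4 subKn // leq_card4.
Qed.

Lemma hodgeinv_homog k w :
  (k < 4)%N -> w \in homog (4 - k.+1).+1 -> hodgeinv w \in homog k.
Proof.
move=> k4 /homogP hw; apply/homogP => I Ik; rewrite ffunE.
rewrite hw ?mwconj0 ?scaler0 //; apply: contra Ik.
rewrite card_setC4 subnSK // => /eqP E.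
by rewrite -(subKn (leq_card4 I)) E subKn // ltnW.
Qed.

Definition dx (f : B) (mu : 'I_4) : forms :=
  [ffun I : {set 'I_4} => if I == [set mu] then f else 0].

Fact dx_homog f mu : dx f mu \in homog 1.
Proof.
apply/homogP => I I1; rewrite ffunE; case: eqP => // EI.
by rewrite EI cards1 in I1.
Qed.

(* f dx^mu *)
Definition form1 (f : B) (mu : 'I_4) : Omega 1 := MkOmega (dx_homog f mu).

Definition ext_d k (w : Omega k) : Omega k.+1 :=
  MkOmega (dform_homog (Omega_homog w)).

Definition wedge k l (v : Omega k) (w : Omega l) : Omega (k + l) :=
  MkOmega (wedgeform_homog (Omega_homog v) (Omega_homog w)).

Definition hodge k (w : Omega k) : Omega (4 - k) :=
  MkOmega (hodgeform_homog (Omega_homog w)).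

Fact bracket_homog l (a : Omega 1) (b : Omega l) :
  wedgeform a b - (-1) ^+ l *: wedgeform b a \in homog l.+1.
Proof.
rewrite rpredB ?rpredZ //; first exact: wedgeform_homog (Omega_homog a) (Omega_homog b).
by rewrite -(addn1 l); exact: wedgeform_homog (Omega_homog b) (Omega_homog a).
Qed.

(* The graded commutator of a 1-form and an l-form. *)
Definition bracket l (a : Omega 1) (b : Omega l) : Omega l.+1 :=
  MkOmega (bracket_homog a b).

Fact codiff_homog k (w : Omega k.+1) :
  (-1) ^+ k.+1 *: hodgeinv (ext_d (hodge w)) \in homog k.
Proof.
rewrite rpredZ //; have [k4|k4] := ltnP k 4.
  by apply: hodgeinv_homog => //; exact: Omega_homog.
rewrite /= (@homog_gt4 k.+1 w) ?Omega_homog //.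
by rewrite hodgeform0 dform0 hodgeinv0 rpred0.
Qed.

Definition codiff k (w : Omega k.+1) : Omega k := MkOmega (codiff_homog w).

Fact codiffS_homog k (a : Omega 1) (w : Omega k.+1) :
  ((-1) ^+ k * 'i%C) *: hodgeinv (bracket a (hodge w)) \in homog k.
Proof.
rewrite rpredZ //; have [k4|k4] := ltnP k 4.
  by apply: hodgeinv_homog => //; exact: Omega_homog.
rewrite /= (@homog_gt4 k.+1 w) ?Omega_homog //.
by rewrite hodgeform0 wedgeformr0 wedgeform0r scaler0 subr0 hodgeinv0 rpred0.
Qed.

(* The adjoint of w |-> i [a, w], where a is the value of the gauge potential. *)
Definition codiffS_form k (a : Omega 1) (w : Omega k.+1) : Omega k :=
  MkOmega (codiffS_homog a w).

End Forms.

Section Gauge.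
Variables (R : realType) (G : vectType R[i]) (v0 : G).

Section LinearExtension.
Variables (W : lmodType R[i]) (w : W).

(* When v0 is a basis of G, the linear map sending v0 to w. *)
Definition linext (v : G) : W := coord [tuple v0] ord0 v *: w.

Fact linext_is_linear : linear linext.
Proof. by move=> c u v; rewrite /linext linearP scalerDl scalerA. Qed.

HB.instance Definition _ :=
  GRing.isLinear.Build R[i] G W *:%R linext linext_is_linear.

End LinearExtension.

Lemma linextE (W : lmodType R[i]) (w : W) :
  basis_of {:G} [:: v0] -> linext w v0 = w.
Proof.
move=> b0; rewrite /linext (_ : coord _ _ _ = 1) ?scale1r //.
by rewrite (coord_free ord0 ord0 (X := [tuple v0])) // (basis_free b0).
Qed.

Definition field_strength (A : {linear G -> Omega R 1}) :
    {linear G -> Omega R 2} :=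
  linext (ext_d (A v0) - 'i%C *: (wedge (A v0) (A v0) : Omega R 2)).

Definition codiffS k (A : {linear G -> Omega R 1})
    (T : {linear G -> Omega R k.+1}) : {linear G -> Omega R k} :=
  linext (codiffS_form (A v0) (T v0)).

End Gauge.

Section Vectors.
Variable R : realType.
Local Notation B := (MoyalWeyl R).

Definition vec : Type := {ffun 'I_3 -> B}.
HB.instance Definition _ := GRing.Lmodule.copy vec {ffun 'I_3 -> B}.

Implicit Types (f h : B) (U V : vec).

(* The component V j is the one usually written V_{j+1}. *)
Definition space (j : 'I_3) : 'I_4 := lift ord0 j.

Definition comm f h : B := moyal f h - moyal h f.
Definition commBV f V : vec := [ffun j => comm f (V j)].
Definition commVB V f : vec := [ffun j => comm (V j) f].
Definition commVV U V : B := \sum_(j < 3) comm (U j) (V j).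

Definition vconj V : vec := [ffun j => mwconj (V j)].

(* Addition in 'I_3 is modulo 3, which gives the cyclic index convention. *)
Definition cross U V : vec :=
  [ffun j => moyal (U (j + 1)) (V (j + 2)) - moyal (U (j + 2)) (V (j + 1))].

Definition grad f : vec := [ffun j => pd (space j) f].
Definition div V : B := \sum_(j < 3) pd (space j) (V j).
Definition curl V : vec :=
  [ffun j => pd (space (j + 1)) (V (j + 2)) - pd (space (j + 2)) (V (j + 1))].
Definition dt V : vec := [ffun j => pd ord0 (V j)].

Section Fields.
Variables (phi : B) (A : vec).

Definition potential_form : Omega R 1 :=
  form1 phi ord0 - \sum_(j < 3) form1 (A j) (space j).

Definition fieldE : vec := - dt A - grad phi.
Definition fieldD : vec := fieldE + 'i%C *: commBV phi A.
Definition fieldB : vec := curl A.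
Definition fieldH : vec := fieldB + 'i%C *: cross A A.

Definition rho_e : B := 'i%C *: commVV fieldD (vconj A).
Definition j_e : vec :=
  'i%C *: commVB fieldD (mwconj phi)
  - 'i%C *: (cross fieldH (vconj A) + cross (vconj A) fieldH).

End Fields.
End Vectors.

(* Main.v *)
Require Import Defs.
From HB Require Import structures.
From mathcomp Require Import all_boot all_order all_algebra.
From mathcomp Require Import complex reals boolp functions normedtype.
From mathcomp Require Import derive.
Set Implicit Arguments.
Unset Strict Implicit.
Unset Printing Implicit Defensive.
Import GRing.Theory.
Local Open Scope ring_scope.

(**
In four-dimensional notation the claim is the usual rewriting of the Yang-Mills
equation D^mu F_{mu nu} = 0 as a Gauss law (nu = 0) and an Ampere law
(nu = 1, 2, 3); what is specific to the Moyal algebra is the position of the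
complex conjugations.

Write F_{mu nu} for the antisymmetric components of F ([comp2]) and a_mu for
those of the potential.  Wedging with a 1-form has the same combinatorial shape
as the exterior derivative: the coefficient of dx^K in the graded commutator
[a, b] is a signed sum over mu in K of [a_mu, b_(K - mu)] ([bracketE]), just as
the one of db is a signed sum of d_mu b_(K - mu).  This has two consequences.

- The coefficients of F = da - i a /\ a are
  F_{mu nu} = d_mu a_nu - d_nu a_mu - i [a_mu, a_nu] ([comp2_curvature]), and
  these are D_j for (mu, nu) = (0, j) and -H_j for (mu, nu) = (j+1, j+2), the
  spatial indices being cyclic ([curvature_electric], [curvature_magnetic]).
- In (Hodge)^-1 o (d - i [a, -]) o (Hodge) the passages to complementary sets
  cancel, and all the signs collapse to the Minkowski metric eta
  ([hodge_wedge_sign]).  The Hodge operator is antilinear, so the coefficient F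
  is conjugated, put in a commutator with a_mu, and conjugated again.  Because
  conjugation reverses the Moyal product ([mwconj_moyal]: it changes the sign of
  i, and the antisymmetry of theta compensates this by exchanging the factors),
  [a_mu, F^*]^* = [F, a_mu^*].  Hence the dx^nu coefficient of the dynamical
  equation is - sum_mu eta_mu (d_mu F_{mu nu} + i [F_{mu nu}, a_mu^*])
  ([yang_mills_component]).

Substituting a_0 = phi, a_j = - A_j and the values of F_{mu nu} turns the
coefficient nu = 0 into rho^e - div D, and the coefficient nu = j into the j-th
entry of curl H - dD/dx^0 - j^e; the equivalence is read off from there.
*)

(** * Linearity and conjugation of the Moyal product *)

Section MoyalAlgebra.
Variable R : realType.
Local Notation B := (MoyalWeyl R).
Implicit Types (c : R[i]) (f h : B).

Lemma conjc_i : conjc 'i%C = - 'i%C :> R[i].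
Proof. by apply/eqP; rewrite eq_complex /= oppr0 !eqxx. Qed.

Lemma Cinf_scaleAl c (u v : Cinf R) : (c *: u) * v = c *: (u * v).
Proof. by apply/val_inj/funext => x; exact/esym/mulrA. Qed.

Lemma Cinf_scaleAr c (u v : Cinf R) : u * (c *: v) = c *: (u * v).
Proof. by rewrite mulrC Cinf_scaleAl mulrC. Qed.

Lemma pdZ mu c f : pd mu (c *: f) = c *: pd mu f.
Proof.
apply/funext => g; apply/val_inj/funext => x; rewrite /= !fctE /partial /=.
have [[_ /(_ mu)[dre _]] [_ /(_ mu)[dim _]]] := Cinf_smooth (f g) 1.
case: c => a b.
set u : 'rV[R]_4 -> R^o := fun y => complex.Re (f g y).
set v : 'rV[R]_4 -> R^o := fun y => complex.Im (f g y).
have -> : (fun y => complex.Re ((Complex a b *: Cinf_fun (f g)) y)) =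
  a \*: u - b \*: v.
  by apply/funext => y; rewrite !fctE /= /u /v; case: (f g y).
have -> : (fun y => complex.Im ((Complex a b *: Cinf_fun (f g)) y)) =
  a \*: v + b \*: u.
  by apply/funext => y; rewrite !fctE /= /u /v; case: (f g y).
have du (k : R) : derivable (k \*: u) x (base R mu) by exact: derivableZ.
have dv (k : R) : derivable (k \*: v) x (base R mu) by exact: derivableZ.
by rewrite deriveB // deriveD // !deriveZ.
Qed.

Lemma pdN mu f : pd mu (- f) = - pd mu f.
Proof. by rewrite -scaleN1r pdZ scaleN1r. Qed.

(** Conjugation being a morphism of rings lets it pass through the sums and
products that define the formal power series. *)
Fact Cinf_conj_zmod_morphism : zmod_morphism (@Cinf_conj R).
Proof. by move=> u v; apply/val_inj/funext => x; exact: rmorphB. Qed.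

Fact Cinf_conj_monoid_morphism : monoid_morphism (@Cinf_conj R).
Proof.
split; first by apply/val_inj/funext => x; exact: rmorph1.
by move=> u v; apply/val_inj/funext => x; exact: rmorphM.
Qed.

HB.instance Definition _ := GRing.isZmodMorphism.Build (Cinf R) (Cinf R)
  (@Cinf_conj R) Cinf_conj_zmod_morphism.
HB.instance Definition _ := GRing.isMonoidMorphism.Build (Cinf R) (Cinf R)
  (@Cinf_conj R) Cinf_conj_monoid_morphism.

Lemma Cinf_conjZ c (u : Cinf R) : Cinf_conj (c *: u) = conjc c *: Cinf_conj u.
Proof. by apply/val_inj/funext => x; exact: (rmorphM (@conjc R) c (u x)). Qed.

Fact mwconj_zmod_morphism : zmod_morphism (@mwconj R).
Proof. by move=> f h; apply/funext => g; exact: raddfB. Qed.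

HB.instance Definition _ := GRing.isZmodMorphism.Build B B
  (@mwconj R) mwconj_zmod_morphism.

Lemma mwconjZ c f : mwconj (c *: f) = conjc c *: mwconj f.
Proof. by apply/funext => g; exact: Cinf_conjZ. Qed.

Lemma mwconjK : involutive (@mwconj R).
Proof. by move=> f; apply/funext => g; apply/val_inj/funext => x; exact: conjcK. Qed.

Lemma mwconj_pd mu f : mwconj (pd mu f) = pd mu (mwconj f).
Proof.
apply/funext => g; apply/val_inj/funext => x; rewrite /= /partial /=.
have [_ [_ /(_ mu)[dim _]]] := Cinf_smooth (f g) 1.
have -> : (fun y => complex.Re (conjc (f g y))) = (fun y => complex.Re (f g y)).
  by apply/funext => y; case: (f g y).
have -> : (fun y => complex.Im (conjc (f g y))) = - (fun y => complex.Im (f g y)).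
  by apply/funext => y; rewrite !fctE; case: (f g y).
by rewrite deriveN.
Qed.

Lemma mulpsZl c f h : mulps (c *: f) h = c *: mulps f h.
Proof.
apply/funext => g; rewrite [RHS]/= /mulps !fctE scaler_sumr.
by apply: eq_bigr => a _; rewrite Cinf_scaleAl.
Qed.

Lemma mulpsZr c f h : mulps f (c *: h) = c *: mulps f h.
Proof.
apply/funext => g; rewrite [RHS]/= /mulps !fctE scaler_sumr.
by apply: eq_bigr => a _; rewrite Cinf_scaleAr.
Qed.

(** The pairs of exponents that add up to g are exchanged by a |-> g - a. *)
Lemma mulpsC : commutative (@mulps R).
Proof.
move=> f h; apply/funext => g; rewrite /mulps.
pose r (a : {dffun forall p : param, 'I_(g p).+1}) :
  {dffun forall p : param, 'I_(g p).+1} := [ffun p => rev_ord (a p)].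
have rK : involutive r by move=> a; apply/ffunP => p; rewrite !ffunE rev_ordK.
rewrite (reindex_inj (inv_inj rK)); apply: eq_bigr => a _.
rewrite mulrC; congr (h _ * f _); apply/ffunP => p; rewrite !ffunE /= subSS //.
by rewrite subKn // -ltnS.
Qed.

Lemma mwconj_mulps f h : mwconj (mulps f h) = mulps (mwconj f) (mwconj h).
Proof.
apply/funext => g; rewrite /mwconj /mulps raddf_sum.
by apply: eq_bigr => a _; exact: rmorphM.
Qed.

Lemma theta_antisym mu nu : theta R nu mu = - theta R mu nu.
Proof.
apply/funext => g; rewrite [RHS]/= /theta.
case: insubP => [p lt1 _|_]; case: insubP => [q lt2 _|_]; rewrite ?opprK ?oppr0 //.
by move: lt1 lt2 => /= /ltnW; rewrite ltnNge => ->.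
Qed.

Lemma mwconj_theta mu nu : mwconj (theta R mu nu) = theta R mu nu.
Proof.
apply/funext => g; rewrite /mwconj /theta.
case: insub => [p|]; first exact: rmorph_nat.
case: insub => [p|]; last exact: raddf0.
by rewrite raddfN; congr (- _); exact: rmorph_nat.
Qed.

Lemma bidiffZl n c f h : bidiff n (c *: f) h = c *: bidiff n f h.
Proof.
elim: n f h => [|n IH] f h /=; first exact: mulpsZl.
rewrite scaler_sumr; apply: eq_bigr => mu _; rewrite scaler_sumr.
by apply: eq_bigr => nu _; rewrite pdZ IH mulpsZr.
Qed.

Lemma bidiffZr n c f h : bidiff n f (c *: h) = c *: bidiff n f h.
Proof.
elim: n f h => [|n IH] f h /=; first exact: mulpsZr.
rewrite scaler_sumr; apply: eq_bigr => mu _; rewrite scaler_sumr.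
by apply: eq_bigr => nu _; rewrite pdZ IH mulpsZr.
Qed.

(** Conjugation fixes theta and commutes with the partial derivatives, so only
the order of the two factors is at stake.  Exchanging them transposes theta, and
each of the n occurrences of theta then contributes a sign. *)
Lemma mwconj_bidiff n f h :
  mwconj (bidiff n f h) = (-1) ^+ n *: bidiff n (mwconj h) (mwconj f).
Proof.
elim: n f h => [|n IH] f h /=; first by rewrite mwconj_mulps mulpsC scale1r.
rewrite [in RHS]exchange_big scaler_sumr raddf_sum; apply: eq_bigr => mu _.
rewrite raddf_sum scaler_sumr; apply: eq_bigr => nu _ /=.
rewrite mwconj_mulps mwconj_theta IH !mwconj_pd theta_antisym mulpsZr.
by rewrite -[- theta _ _ _]scaleN1r mulpsZl scalerA exprS mulrC.
Qed.

Lemma moyalZl c f h : moyal (c *: f) h = c *: moyal f h.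
Proof.
apply/funext => g; rewrite [RHS]/= /moyal !fctE scaler_sumr.
by apply: eq_bigr => n _; rewrite bidiffZl !scalerA mulrC.
Qed.

Lemma moyalZr c f h : moyal f (c *: h) = c *: moyal f h.
Proof.
apply/funext => g; rewrite [RHS]/= /moyal !fctE scaler_sumr.
by apply: eq_bigr => n _; rewrite bidiffZr !scalerA mulrC.
Qed.

(** This sign is the one produced by [mwconj_bidiff], so that the two cancel in
every term of the exponential series. *)
Lemma conjc_exp_coef n :
  conjc (n`!%:R^-1 * ('i%C / 2) ^+ n) =
  (-1) ^+ n * (n`!%:R^-1 * ('i%C / 2) ^+ n) :> R[i].
Proof.
rewrite rmorphM fmorphV rmorph_nat rmorphXn mulrCA -exprMn.
by rewrite fmorph_div rmorph_nat [X in X / _]conjc_i mulN1r mulNr.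
Qed.

Lemma mwconj_moyal f h : mwconj (moyal f h) = moyal (mwconj h) (mwconj f).
Proof.
apply/funext => g; rewrite /mwconj /moyal raddf_sum; apply: eq_bigr => n _.
apply: (etrans (Cinf_conjZ _ _)).
rewrite -[Cinf_conj _]/(mwconj (bidiff n f h) g) mwconj_bidiff.
rewrite conjc_exp_coef [X in _ *: X](_ : _ =
  (-1) ^+ n *: bidiff n (mwconj h) (mwconj f) g) //.
by rewrite scalerA mulrAC -expr2 sqrr_sign mul1r.
Qed.

Lemma comm_antisym f h : comm f h = - comm h f.
Proof. by rewrite opprB. Qed.

Lemma comm0f f : comm 0 f = 0.
Proof. by rewrite /comm moyalr0 moyal0r subrr. Qed.

Lemma commf0 f : comm f 0 = 0.
Proof. by rewrite /comm moyalr0 moyal0r subrr. Qed.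

Lemma commZl c f h : comm (c *: f) h = c *: comm f h.
Proof. by rewrite /comm moyalZl moyalZr scalerBr. Qed.

Lemma commZr c f h : comm f (c *: h) = c *: comm f h.
Proof. by rewrite /comm moyalZl moyalZr scalerBr. Qed.

Lemma commNl f h : comm (- f) h = - comm f h.
Proof. by rewrite -scaleN1r commZl scaleN1r. Qed.

Lemma commNr f h : comm f (- h) = - comm f h.
Proof. by rewrite -scaleN1r commZr scaleN1r. Qed.

Lemma mwconj_comm f h : mwconj (comm f h) = comm (mwconj h) (mwconj f).
Proof. by rewrite raddfB /= !mwconj_moyal. Qed.

End MoyalAlgebra.

(** * Signs of the wedge product and of the Hodge operator *)

Section WedgeSigns.
Variable R : realType.
Implicit Types (mu nu : 'I_4) (I J K : {set 'I_4}).

Lemma wedge_sign1l mu J :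
  wedge_sign R [set mu] J = (-1) ^+ #|[set nu in J | (nu < mu)%N]|.
Proof.
rewrite /wedge_sign -(card_imset (mem [set nu in J | (nu < mu)%N])
  (f := fun nu => (mu, nu))) => [|k l []//].
congr (_ ^+ #|pred_of_set _|); apply/setP => -[k l]; rewrite !inE /=.
apply/and3P/imsetP => [[/eqP-> lJ lk]|[m]]; first by exists l; rewrite ?inE ?lJ.
by rewrite !inE => /andP[mJ mlt] [-> ->].
Qed.

Lemma wedge_sign1r mu J :
  wedge_sign R J [set mu] = (-1) ^+ #|[set nu in J | (mu < nu)%N]|.
Proof.
rewrite /wedge_sign -(card_imset (mem [set nu in J | (mu < nu)%N])
  (f := fun nu => (nu, mu))) => [|k l []//].
congr (_ ^+ #|pred_of_set _|); apply/setP => -[k l]; rewrite !inE /=.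
apply/and3P/imsetP => [[kJ /eqP-> lk]|[m]]; first by exists k; rewrite ?inE ?kJ.
by rewrite !inE => /andP[mJ mlt] [-> ->].
Qed.

(** Each element of J lies either below or above mu, so the two signs together
count J once. *)
Lemma wedge_sign_swap mu J : mu \notin J ->
  wedge_sign R J [set mu] = (-1) ^+ #|J| * wedge_sign R [set mu] J.
Proof.
move=> muJ; rewrite wedge_sign1l wedge_sign1r.
rewrite -(cardsID [set nu : 'I_4 | (nu < mu)%N] J) exprD.
have -> : J :&: [set nu : 'I_4 | (nu < mu)%N] = [set nu in J | (nu < mu)%N].
  by apply/setP => nu; rewrite !inE.
have -> : J :\: [set nu : 'I_4 | (nu < mu)%N] = [set nu in J | (mu < nu)%N].
  apply/setP => nu; rewrite !inE andbC; case: (boolP (nu \in J)) => //= nuJ.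
  rewrite -leqNgt leq_eqVlt; case: eqVneq => // /val_inj E.
  by rewrite E nuJ in muJ.
by rewrite mulrAC -expr2 sqrr_sign mul1r.
Qed.

Lemma wedge_sign11 mu nu : wedge_sign R [set mu] [set nu] = (-1) ^+ (nu < mu)%N.
Proof.
rewrite wedge_sign1l; case: ltnP => lt.
  rewrite (_ : [set _ in _ | _] = [set nu]) ?cards1 //.
  by apply/setP => k; rewrite !inE; case: eqP => // ->.
rewrite (_ : [set _ in _ | _] = finset.set0) ?cards0 //.
by apply/setP => k; rewrite !inE; case: eqP => // ->; rewrite ltnNge lt.
Qed.

(** This form lets equality tests between explicit sets of indices be evaluated
by computation. *)
Lemma eq_set_big I J : (I == J) = \big[andb/true]_(mu < 4) ((mu \in I) == (mu \in J)).
Proof.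
rewrite big_all; apply/eqP/allP => [-> //|IJ]; apply/setP => mu.
by apply/eqP/IJ; rewrite mem_index_enum.
Qed.

(** The diagonal of the Minkowski metric diag(1, -1, -1, -1). *)
Definition minkowski mu : R[i] := if mu == ord0 then 1 else -1.

(** The signs met along the path dx^mu dx^nu -> its Hodge dual -> wedge with
dx^mu -> inverse Hodge operator at dx^nu multiply to the metric, up to the sign
that orders dx^mu and dx^nu; this is where the table of the Hodge operator
enters, through the twelve pairs of distinct indices. *)
Lemma hodge_wedge_sign mu nu : mu != nu ->
  hodge_sign R [set nu] * wedge_sign R [set mu] (~: [set nu] :\ mu)
    * hodge_sign R [set mu; nu] = - (minkowski mu * wedge_sign R [set mu] [set nu]).
Proof.
rewrite wedge_sign11 wedge_sign1l -sum1dep_card big_mkcond !big_ord_recl big_ord0.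
rewrite /hodge_sign /minkowski !inE /mset.
rewrite !eq_set_big !big_ord_recl !big_ord0 !inE.
case: mu => [[|[|[|[|//]]]] ?]; case: nu => [[|[|[|[|//]]]] ?] //= _;
  rewrite !(addn0, add0n, addn1) ?(sqrrN, expr1n, expr0, expr1);
  by rewrite !(mulr1, mul1r, mulrN1, mulN1r, opprK).
Qed.

End WedgeSigns.

(** * Components of the bracket, the curvature and the dynamical equation *)

Section FormComponents.
Variable R : realType.
Local Notation B := (MoyalWeyl R).
Implicit Types (mu nu : 'I_4) (I J K : {set 'I_4}) (a w : forms R).

Lemma sum_subset_card1 K (F : {set 'I_4} -> B) :
  (forall I, I \subset K -> #|I| != 1%N -> F I = 0) ->
  \sum_(I : {set 'I_4} | I \subset K) F I = \sum_(mu in K) F [set mu].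
Proof.
move=> F0; rewrite -(big_imset F (h := set1)) /=; last by move=> ? ? _ _ /set1_inj.
rewrite big_mkcond [RHS]big_mkcond; apply: eq_bigr => I _.
case: imsetP => [[mu muK ->]|nI]; first by rewrite sub1set muK.
case: ifP => // IK; apply: F0 => //; apply/cards1P => -[mu E]; apply: nI.
by exists mu; rewrite // -sub1set -E.
Qed.

Lemma wedgeform_1l a w K : a \in homog 1 ->
  wedgeform a w K = \sum_(mu in K)
    wedge_sign R [set mu] (K :\ mu) *: moyal (a [set mu]) (w (K :\ mu)).
Proof.
move=> /homogP a1; rewrite ffunE.
apply: (sum_subset_card1 (F := fun I =>
  wedge_sign R I (K :\: I) *: moyal (a I) (w (K :\: I)))) => I _ I1.
by rewrite a1 // moyal0r scaler0.
Qed.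

Lemma wedgeform_1r a w K : a \in homog 1 ->
  wedgeform w a K = \sum_(mu in K)
    wedge_sign R (K :\ mu) [set mu] *: moyal (w (K :\ mu)) (a [set mu]).
Proof.
move=> /homogP a1; rewrite ffunE.
have KDK I : I \subset K -> K :\: (K :\: I) = I.
  by move=> IK; rewrite finset.setDDr setDv finset.set0U; apply/setIidPr.
(* Sum over the complement in K, so that the factor of degree one is the index. *)
rewrite (reindex_onto (fun I => K :\: I) (fun I => K :\: I)) => [|I]; last exact: KDK.
rewrite (eq_bigl (fun I : {set 'I_4} => I \subset K)) => [|I]; last first.
  rewrite subsetDl /=; apply/eqP/idP => [<-|]; [exact: subsetDl | exact: KDK].
rewrite (sum_subset_card1 (F := fun I => wedge_sign R (K :\: I) (K :\: (K :\: I)) *: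
  moyal (w (K :\: I)) (a (K :\: (K :\: I))))) => [|I IK I1].
  by apply: eq_bigr => mu muK; rewrite KDK ?sub1set.
by rewrite KDK // a1 // moyalr0 scaler0.
Qed.

(** The graded commutator is a signed sum of plain commutators because the sign
(-1)^l in its definition is the one that moves dx^mu past an l-form. *)
Lemma bracketE l (a : Omega R 1) (b : Omega R l) K :
  (bracket a b : forms R) K = \sum_(mu in K) wedge_sign R [set mu] (K :\ mu) *:
    comm ((a : forms R) [set mu]) ((b : forms R) (K :\ mu)).
Proof.
rewrite [LHS](_ : _ = wedgeform a b K - (-1) ^+ l *: wedgeform b a K); last first.
  by rewrite /= !ffunE.
rewrite wedgeform_1l ?wedgeform_1r ?Omega_homog // scaler_sumr -sumrB.
apply: eq_bigr => mu muK; rewrite wedge_sign_swap ?setD11 //.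
(* If what is left of K does not have l elements, both sides vanish. *)
have [->|nl] := eqVneq #|K :\ mu| l; last first.
  by rewrite (homogP _ _ (Omega_homog b)) // commf0 moyalr0 moyal0r !scaler0 subr0.
by rewrite !scalerA mulrA -expr2 sqrr_sign mul1r scalerBr.
Qed.

(** The antisymmetric coefficient w_{mu nu}: the coefficient of the unordered
pair, signed by the order of mu and nu.  It is junk for mu = nu, except on
2-forms, where it vanishes ([comp2_diag]). *)
Definition comp2 w mu nu : B := wedge_sign R [set mu] [set nu] *: w [set mu; nu].

Lemma wedge_sign_sqr I J : wedge_sign R I J * wedge_sign R I J = 1.
Proof. by rewrite -expr2 sqrr_sign. Qed.

(** Both d and wedging with a 1-form have coefficients of the shape assumed here,
and the two elements of a pair are taken out of it with opposite signs. *)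
Lemma comp2_sum w (G : 'I_4 -> {set 'I_4} -> B) mu nu :
  mu != nu ->
  (forall K, w K = \sum_(k in K) wedge_sign R [set k] (K :\ k) *: G k (K :\ k)) ->
  comp2 w mu nu = G mu [set nu] - G nu [set mu].
Proof.
move=> mn wE; have nm : nu != mu by rewrite eq_sym.
rewrite /comp2 wE big_setU1 ?inE //= big_set1 setU1K ?inE //.
rewrite [in X in _ + X]finset.setUC setU1K ?inE // scalerDr !scalerA.
rewrite wedge_sign_sqr scale1r [X in _ + (_ * X) *: _]wedge_sign_swap ?inE //.
by rewrite cards1 expr1 mulN1r mulrN wedge_sign_sqr scaleN1r.
Qed.

Lemma comp2_diag (w : Omega R 2) mu : comp2 w mu mu = 0.
Proof.
by rewrite /comp2 finset.setUid (homogP _ _ (Omega_homog w)) ?scaler0 ?cards1.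
Qed.

Lemma comp2_curvature (a : Omega R 1) mu nu :
  comp2 (ext_d a - 'i%C *: (wedge a a : Omega R 2)) mu nu =
  pd mu ((a : forms R) [set nu]) - pd nu ((a : forms R) [set mu])
  - 'i%C *: comm ((a : forms R) [set mu]) ((a : forms R) [set nu]).
Proof.
have [->|mn] := eqVneq mu nu.
  by rewrite comp2_diag /comm !subrr scaler0 subrr.
rewrite (comp2_sum (G := fun k J => pd k ((a : forms R) J) - 'i%C *:
  moyal ((a : forms R) [set k]) ((a : forms R) J)) mn) => [|K].
  by rewrite scalerBr !opprB addrACA [RHS]addrAC -!addrA; congr (_ + _); rewrite !addrA.
rewrite [LHS](_ : _ = dform a K - 'i%C *: wedgeform a a K); last first.
  by rewrite /= !ffunE.
rewrite wedgeform_1l ?Omega_homog // ffunE scaler_sumr -sumrB.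
by apply: eq_bigr => k _; rewrite scalerBr !scalerA mulrC.
Qed.

Lemma conjc_wedge_sign I J : conjc (wedge_sign R I J) = wedge_sign R I J.
Proof. exact: rmorph_sign. Qed.

Lemma conjc_hodge_sign I : conjc (hodge_sign R I) = hodge_sign R I.
Proof. by rewrite /hodge_sign; case: ifP => _; rewrite ?rmorphN1 ?rmorph1. Qed.

Lemma hodgeform_setC1D1 w mu nu :
  hodgeform w (~: [set nu] :\ mu) =
  hodge_sign R [set mu; nu] *: mwconj (w [set mu; nu]).
Proof. by rewrite ffunE setCD finset.setCK finset.setUC. Qed.

Lemma Omega_formB k (v w : Omega R k) I :
  (v - w : forms R) I = (v : forms R) I - (w : forms R) I.
Proof. by rewrite ffunE ffunE. Qed.

Lemma codiffE k (w : Omega R k.+1) I :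
  (codiff w : forms R) I =
  (-1) ^+ k.+1 *: (hodge_sign R I *: mwconj (dform (hodgeform w) (~: I))).
Proof. by rewrite ffunE [hodgeinv _ _]ffunE. Qed.

Lemma codiffS_formE k (a : Omega R 1) (w : Omega R k.+1) I :
  (codiffS_form a w : forms R) I =
  ((-1) ^+ k * 'i%C) *: (hodge_sign R I *:
    mwconj ((bracket a (hodge w) : forms R) (~: I))).
Proof. by rewrite ffunE [hodgeinv _ _]ffunE. Qed.

(** Since the bracket has the same shape as d, both parts of the equation carry
the sign of [hodge_wedge_sign].  The two conjugations around the commutator
reverse it, which moves the conjugate onto a. *)
Lemma yang_mills_component (a : Omega R 1) (F : Omega R 2) nu :
  ((codiff F - codiffS_form a F : Omega R 1) : forms R) [set nu] =
  - \sum_(mu < 4) minkowski R mu *: (pd mu (comp2 F mu nu)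
      + 'i%C *: comm (comp2 F mu nu) (mwconj ((a : forms R) [set mu]))).
Proof.
rewrite Omega_formB codiffE codiffS_formE bracketE [dform _ _]ffunE.
rewrite !raddf_sum -big_split [RHS](bigD1 nu) //= comp2_diag.
(* Only the indices other than nu occur on the left: the term mu = nu is zero. *)
rewrite [X in _ = X + _](_ : _ = 0) ?add0r; last first.
  by rewrite partial0 /comm moyalr0 moyal0r subrr scaler0 addr0 scaler0 oppr0.
apply: eq_big => [mu|mu]; rewrite !inE // => mn.
rewrite hodgeform_setC1D1 pdZ commZr !mwconjZ !conjc_wedge_sign !conjc_hodge_sign.
rewrite mwconj_pd mwconj_comm mwconjK /comp2 pdZ commZl !scalerA.
rewrite expr1 mulN1r !mulNr scaleNr opprK expr2 mulN1r opprK mul1r.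
rewrite hodge_wedge_sign // mulrN !scaleNr -opprD.
by rewrite [in RHS]scalerDr !scalerA [in RHS]mulrCA.
Qed.

Lemma Omega1_eq0 (w : Omega R 1) :
  w = 0 <-> forall mu, (w : forms R) [set mu] = 0.
Proof.
split=> [-> mu|w0]; first by rewrite ffunE.
apply/val_inj/ffunP => I; rewrite [RHS]ffunE.
have [/cards1P[mu ->]|I1] := boolP (#|I| == 1%N); first exact: w0.
exact: (homogP _ _ (Omega_homog w)).
Qed.

End FormComponents.

(** * The electric and magnetic components *)

Lemma sum_cyclic (V : nmodType) (G : 'I_3 -> V) j :
  \sum_(k < 3) G k = G j + G (j + 1) + G (j + 2).
Proof.
rewrite (reindex_inj (addrI j)) !big_ord_recl big_ord0 /= !addr0 -[RHS]addrA.
congr (_ + (_ + _)); [congr (G (j + _)) | congr (G (j + _))]; exact: val_inj.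
Qed.

Section Fields.
Variables (R : realType) (phi : MoyalWeyl R) (A : vec R).
Local Notation B := (MoyalWeyl R).
Local Notation space := Defs.space.
Implicit Types (mu nu : 'I_4) (j : 'I_3).

Lemma potential_formE mu :
  (potential_form phi A : forms R) [set mu] =
  (if mu == ord0 then phi else 0) - \sum_(j < 3) (if mu == space j then A j else 0).
Proof.
rewrite /potential_form Omega_formB ffunE (inj_eq set1_inj); congr (_ - _).
pose ev (w : Omega R 1) : B := (w : forms R) [set mu].
have ev0 : ev 0 = 0 by rewrite /ev ffunE.
have evD : {morph ev : v w / v + w} by move=> v w; rewrite /ev ffunE.
rewrite -/(ev _) (big_morph _ evD ev0); apply: eq_bigr => j _.
by rewrite /ev ffunE (inj_eq set1_inj).
Qed.

Lemma potential_form0 : (potential_form phi A : forms R) [set ord0] = phi.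
Proof. by rewrite potential_formE eqxx big1 ?subr0. Qed.

Lemma potential_form_space j : (potential_form phi A : forms R) [set space j] = - A j.
Proof.
rewrite potential_formE /= sub0r (bigD1 j) //= eqxx big1 ?addr0 // => k kj.
by rewrite (inj_eq lift_inj) eq_sym (negbTE kj).
Qed.

Definition curvature_form : Omega R 2 :=
  ext_d (potential_form phi A) -
  'i%C *: (wedge (potential_form phi A) (potential_form phi A) : Omega R 2).

Lemma curvature_antisym mu nu :
  comp2 curvature_form nu mu = - comp2 curvature_form mu nu.
Proof.
by rewrite !comp2_curvature comm_antisym scalerN opprD opprB opprK.
Qed.

Lemma curvature_electric j : comp2 curvature_form ord0 (space j) = fieldD phi A j.
Proof.
rewrite comp2_curvature potential_form0 potential_form_space pdN commNr scalerN opprK.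
by rewrite !ffunE.
Qed.

(** With the cyclic convention on spatial indices, one formula covers F_{12},
F_{23} and F_{31}. *)
Lemma curvature_magnetic j :
  comp2 curvature_form (space (j + 1)) (space (j + 2)) = - fieldH A j.
Proof.
rewrite comp2_curvature !potential_form_space !pdN commNl commNr !opprK.
by rewrite !ffunE opprD opprB [- _ + _]addrC.
Qed.

Lemma gauss_component :
  ((codiff curvature_form - codiffS_form (potential_form phi A) curvature_form
    : Omega R 1) : forms R) [set ord0] = rho_e phi A - div (fieldD phi A).
Proof.
rewrite yang_mills_component big_ord_recl comp2_diag partial0 /comm moyalr0 moyal0r.
rewrite subrr scaler0 addr0 scaler0 add0r /rho_e /commVV /div scaler_sumr -sumrB -sumrN.
apply: eq_bigr => j _; rewrite -/(space j) -/(comm _ _) /minkowski scaleN1r opprK.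
rewrite curvature_antisym curvature_electric potential_form_space.
rewrite pdN raddfN commNl commNr opprK addrC.
by rewrite !ffunE.
Qed.

(** The indices mu different from j are 0, j+1 and j+2: the first gives - dD/dx^0
and the commutator with phi^*, the other two the curl and the cross products. *)
Lemma ampere_component j :
  ((codiff curvature_form - codiffS_form (potential_form phi A) curvature_form
    : Omega R 1) : forms R) [set space j] =
  (curl (fieldH A) - dt (fieldD phi A) - j_e phi A) j.
Proof.
(* Addition on the three spatial indices is modulo 3. *)
have j21 : j + 2 + 1 = j by rewrite -addrA -[RHS]addr0; congr (_ + _); exact: val_inj.
have j22 : j + 2 + 2 = j + 1 by rewrite -addrA; congr (_ + _); exact: val_inj.
have j11 : j + 1 + 1 = j + 2 by rewrite -addrA.
have j12 : j + 1 + 2 = j by rewrite addrAC.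
have F1 : comp2 curvature_form (space (j + 1)) (space j) = fieldH A (j + 2).
  by have := curvature_magnetic (j + 2); rewrite j21 j22 curvature_antisym => /oppr_inj.
have F2 : comp2 curvature_form (space (j + 2)) (space j) = - fieldH A (j + 1).
  by have := curvature_magnetic (j + 1); rewrite j11 j12.
have crossE : (cross (fieldH A) (vconj A) + cross (vconj A) (fieldH A)) j =
    comm (fieldH A (j + 1)) (mwconj (A (j + 2))) -
    comm (fieldH A (j + 2)) (mwconj (A (j + 1))).
  rewrite ffunE [cross _ _ j]ffunE [cross (vconj A) _ j]ffunE ![vconj _ _]ffunE /comm.
  by rewrite opprB addrACA [RHS]addrACA [X in _ + X = _]addrC.
rewrite yang_mills_component big_ord_recl (sum_cyclic _ j) -!/(space _) F1 F2.
rewrite comp2_diag partial0 /minkowski /= curvature_electric.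
rewrite !potential_form_space potential_form0 !raddfN /=.
rewrite comm0f scaler0 addr0 scaler0 add0r !commNr commNl opprK pdN.
have -> : (curl (fieldH A) - dt (fieldD phi A) - j_e phi A) j =
    pd (space (j + 1)) (fieldH A (j + 2)) - pd (space (j + 2)) (fieldH A (j + 1))
    - pd ord0 (fieldD phi A j)
    - ('i%C *: comm (fieldD phi A j) (mwconj phi) -
       'i%C *: (cross (fieldH A) (vconj A) + cross (vconj A) (fieldH A)) j).
  by rewrite /j_e; move: (fieldH A) (fieldD phi A) => H D; rewrite !ffunE.
(* Both sides consist of the same six terms, in different orders. *)
rewrite crossE [X in _ = _ - (_ - X)]scalerBr scale1r !scaleN1r !scalerN.
by rewrite !(opprD, opprK) !addrA [RHS](ACl (3*4*1*6*2*5)).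
Qed.

End Fields.

(** * Gauss and Ampere laws *)

Theorem theorem3p6 (R : realType) (Gamma : vectType R[i]) (vartheta : Gamma)
    (basis_vartheta : basis_of {:Gamma} [:: vartheta])
    (phi : MoyalWeyl R) (A : vec R)
    (Aomega : {linear Gamma -> Omega R 1})
    (Aomega_vartheta : Aomega vartheta = potential_form phi A) :
  let Fomega := field_strength vartheta Aomega in
  codiff (Fomega vartheta) - codiffS vartheta Aomega Fomega vartheta = 0
  <->
  div (fieldD phi A) = rho_e phi A /\
  curl (fieldH A) - dt (fieldD phi A) = j_e phi A.
Proof.
rewrite /= /codiffS /field_strength !linextE // Aomega_vartheta -/(curvature_form _ _).
rewrite Omega1_eq0; split=> [YM | [gauss ampere] mu].
  split; first by have := YM ord0; rewrite gauss_component => /subr0_eq.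
  apply/subr0_eq/ffunP => j; rewrite -ampere_component [RHS]ffunE.
  exact: YM.
have [j ->|->] := unliftP ord0 mu; last by rewrite gauss_component gauss subrr.
by rewrite [LHS]ampere_component ampere subrr ffunE.
Qed.
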